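(* Let $G$ be a graph of order $n$ without isolated vertices. Then $\chi(G)\leq 2R'(G)$, with equality if and only if $G\cong K_k\bullet K_{1,n-k}$ for some $k\in\{1,\ldots,n\}$.
   Context: Graphs are finite, simple, undirected, with nonempty vertex set; the order of a graph is its number of vertices, $d(u)$ denotes the degree of a vertex $u$ in $G$, and $\chi(G)$ is the chromatic number of $G$. $R'(G)=\sum_{uv\in E(G)}\frac{1}{\max\{d(u),d(v)\}}$. For integers $n\geq k\geq 1$, $K_k\bullet K_{1,n-k}$ denotes the graph of order $n$ obtained by identifying the center of the star $K_{1,n-k}$ with a vertex of the complete graph $K_k$ (that is, attaching $n-k$ pendant vertices to a single vertex of $K_k$). In particular, if $k\in\{1,2\}$, $K_k\bullet K_{1,n-k}\cong K_{1,n-1}$, and if $k=n$, $K_k\bullet K_{1,n-k}\cong K_n$. *)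

(* Defs.v *)
From HB Require Import structures.
From mathcomp Require Import all_boot all_order all_algebra.

Set Implicit Arguments.
Unset Strict Implicit.
Unset Printing Implicit Defensive.

Import Order.TTheory GRing.Theory Num.Theory.

(* Nonemptiness of the vertex set is not part of the structure; it has to be
   assumed separately. *)
Record sgraph := SGraph {
  vertex :> finType;
  adj : rel vertex;
  adj_sym : symmetric adj;
  adj_irrefl : irreflexive adj }.

Section Invariants.
Variable G : sgraph.

Definition deg (u : G) : nat := #|[set v | adj u v]|.

Definition edges : {set {set G}} :=
  [set [set p.1; p.2] | p : G * G & adj p.1 p.2].

(* For an edge A = {u, v}, \max_(w in A) deg w is max {d(u), d(v)}. *)
Definition Rprime : rat :=
  (\sum_(A in edges) ((\max_(w in A) deg w)%N%:R)^-1)%R.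

Definition colorable (k : nat) : bool :=
  [exists c : {ffun G -> 'I_k},
    [forall x, [forall y, adj x y ==> (c x != c y)]]].

Lemma colorable_card : exists k, colorable k.
Proof.
exists #|G|; apply/existsP; exists [ffun x => enum_rank x].
apply/forallP=> x; apply/forallP=> y; apply/implyP=> xy; rewrite !ffunE.
by apply/eqP=> /enum_rank_inj eq_xy; rewrite eq_xy adj_irrefl in xy.
Qed.

Definition chromatic_number : nat := ex_minn colorable_card.

End Invariants.

Definition isomorphic (G H : sgraph) : Prop :=
  exists2 f : G -> H, bijective f & forall x y, adj (f x) (f y) = adj x y.

(* K_k with n - k pendant vertices attached to its vertex 0: inl ranges over
   the vertices of K_k, inr over the pendant ones. Meaningful for
   1 <= k <= n only. *)
Section CliqueStar.
Variables k n : nat.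

Definition clique_star_adj : rel ('I_k + 'I_(n - k))%type := fun x y =>
  match x, y with
  | inl i, inl j => i != j
  | inl i, inr _ | inr _, inl i => i == 0 :> nat
  | inr _, inr _ => false
  end.

Lemma clique_star_sym : symmetric clique_star_adj.
Proof. by move=> [i|i] [j|j] //=; rewrite eq_sym. Qed.

Lemma clique_star_irrefl : irreflexive clique_star_adj.
Proof. by move=> [i|i] //=; rewrite eqxx. Qed.

Definition clique_star : sgraph := SGraph clique_star_sym clique_star_irrefl.

Lemma card_clique_star : k <= n -> #|clique_star| = n.
Proof. by move=> kn; rewrite card_sum !card_ord subnKC. Qed.

End CliqueStar.

(* Main.v *)
Require Import Defs.
From HB Require Import structures.
From mathcomp Require Import all_boot all_order all_algebra.
From mathcomp Require Import zify ring lra.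

Import Order.TTheory GRing.Theory Num.Theory.

(** Why [chi <= 2 R'].  Write [T S] for twice the invariant [R'] of the subgraph
    induced on a vertex set [S] (this is [dweight S] below).  Two facts
    carry the inequality.

    - Minimum degree ([min_degree_dweight_ge]): if all degrees in [S] are at
      least [k >= 1] then [T S >= k + 1].  Peel off vertices in order of
      decreasing degree.  When [j] vertices are gone, the next one, of degree
      [e >= k], still has at least [e - j] edges into the rest, each of weight
      [1 / e], and [(e - j) / e >= (k - j) / k].  Doubling and summing over [j]
      gives [2 (k + (k - 1) + ... + 1) / k = k + 1].

    - Deletion ([dweight_setD1_le]): removing a vertex [v] of minimum degree does
      not increase [T].  Each edge at [v] goes to some [u] of degree at least that
      of [v], so [1 / d(u)] is lost, while each of the other [d(u) - 1] edges at
      [u] gains at most [1 / (d(u) - 1) - 1 / d(u)] from the drop of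
      [d(u)], hence [1 / d(u)] in total.

    Suppose [S] is not [k]-colourable ([dweight_not_colorable]).  If every
    degree is at least [k], the first fact gives [T S >= k + 1].  Otherwise a
    vertex of minimum degree has fewer than [k] neighbours, so deleting it leaves
    a graph that is still not [k]-colourable, and the second fact concludes
    by induction.  The inequality is the case [k = chi - 1].

    Equality.  In the minimum-degree case it forces a star when [k = 1] and a
    complete graph when [k >= 2] ([min_degree_dweight_eq]).  In the deletion step
    it forces the neighbours of [v] to be pairwise nonadjacent and to have larger
    degree than all their other neighbours ([dweight_setD1_eq]); if
    [G - v] is a clique with pendant vertices, [v] can then only be one
    more pendant vertex at the same centre, or the first one
    ([clique_star_add_vertex]).  Conversely a clique [C] with pendant
    vertices has [T <= #|C| <= chi] ([clique_star_dweight_le]). *)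

Set Implicit Arguments.
Unset Strict Implicit.
Unset Printing Implicit Defensive.

(** * Reciprocals of maxima *)

Lemma inv_nat_le (a b : nat) : 0 < a -> a <= b -> (b%:R^-1 <= a%:R^-1 :> rat)%R.
Proof. by move=> a0 ab; rewrite lef_pV2 ?posrE ?ltr0n ?ler_nat //; lia. Qed.

Lemma inv_nat_lt (a b : nat) : 0 < a -> a < b -> (b%:R^-1 < a%:R^-1 :> rat)%R.
Proof. by move=> a0 ab; rewrite ltf_pV2 ?posrE ?ltr0n ?ltr_nat //; lia. Qed.

Section InvMax.
Variables a a' b b' : nat.
Hypotheses (a_gt0 : 0 < a) (b_gt0 : 0 < b) (le_a : a <= a') (le_b : b <= b').
Local Open Scope ring_scope.

Let drop : rat := (maxn a b)%:R^-1 - (maxn a' b')%:R^-1.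
Let budget : rat := (a%:R^-1 - a'%:R^-1) + (b%:R^-1 - b'%:R^-1).

(** The larger of [a'] and [b'] realizes the subtracted maximum, so its own
    reciprocal drop already pays for the left-hand side. *)
Lemma inv_max_drop_le : drop <= budget.
Proof.
have := inv_nat_le a_gt0 le_a; have := inv_nat_le b_gt0 le_b.
have := inv_nat_le a_gt0 (leq_maxl a b); have := inv_nat_le b_gt0 (leq_maxr a b).
by rewrite /drop /budget; case: (leqP a' b') => _; lra.
Qed.

(** If [b'] were the larger one, the positive drop from [a] to [a'] would be
    left over; so [a'] is strictly larger and it is the drop of [b] that must
    vanish. *)
Lemma inv_max_drop_eq : drop = budget -> (a < a')%N -> b = b' /\ (b' < a')%N.
Proof.
move=> eq_db lt_a; have := inv_nat_lt a_gt0 lt_a.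
have := inv_nat_le a_gt0 (leq_maxl a b); have := inv_nat_le b_gt0 (leq_maxr a b).
move: eq_db; rewrite /drop /budget; case: (leqP a' b') => [_|lt_ba].
  by move=> *; exfalso; lra.
move: le_b; rewrite leq_eqVlt => /orP[/eqP-> //|/(inv_nat_lt b_gt0) *].
by exfalso; lra.
Qed.

End InvMax.

(** * Weights of induced subgraphs *)

Section Weight.
Variable G : sgraph.
Implicit Types (u v w x y c : G) (S A C : {set G}) (d : G -> nat) (k : nat).

Definition degin S u : nat := #|[set w in S | adj u w]|.

(** The sum runs over ordered pairs, so each edge counts twice.  The degree
    function is a parameter because degrees stay those of a larger vertex set
    while vertices of [A] are being peeled off. *)
Definition weight d A : rat :=
  (\sum_(u in A) \sum_(w in A) (adj u w)%:R / (maxn (d u) (d w))%:R)%R.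

(** Twice the invariant [R'] of the subgraph induced on [S]. *)
Definition dweight S : rat := weight (degin S) S.

Lemma deginE S u : ((degin S u)%:R = \sum_(w in S) (adj u w)%:R :> rat)%R.
Proof.
rewrite /degin -sum1_card natr_sum (eq_bigl (fun w => (w \in S) && adj u w)).
  by rewrite big_mkcondr; apply: eq_bigr => w _; case: (adj u w).
by move=> w; rewrite inE.
Qed.

Lemma deginD1 A x u : x \in A -> degin A u = adj u x + degin (A :\ x) u.
Proof.
move=> xA; rewrite /degin (cardsD1 x) inE xA /=; congr (_ + _).
by apply: eq_card => w; rewrite !inE andbA.
Qed.

Lemma neighbours_subD1 A u : [set w in A | adj u w] \subset A :\ u.
Proof.
apply/subsetP=> w; rewrite !inE => /andP[-> uw]; rewrite andbT.
by apply: contraTneq uw => ->; rewrite adj_irrefl.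
Qed.

Lemma degin_gt0P S u :
  reflect (exists2 w, w \in S & adj u w) (0 < degin S u).
Proof.
rewrite card_gt0; apply: (iffP (set0Pn _)) => -[w].
  by rewrite inE => /andP[]; exists w.
by exists w; rewrite inE; apply/andP.
Qed.

Lemma weight_ge0 d A : (0 <= weight d A)%R.
Proof.
apply: sumr_ge0 => u _; apply: sumr_ge0 => w _.
by rewrite divr_ge0 ?ler0n.
Qed.

Lemma weight_split d A x : x \in A ->
  (weight d A =
   2%:R * (\sum_(w in A :\ x) (adj x w)%:R / (maxn (d x) (d w))%:R)
     + weight d (A :\ x))%R.
Proof.
move=> xA; rewrite /weight (big_setD1 x) //= (big_setD1 x) //= adj_irrefl mul0r.
under [X in (_ + X = _)%R]eq_bigr => u _ do
  rewrite (big_setD1 x) //= adj_sym maxnC.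
rewrite big_split /=; ring.
Qed.

Lemma weight_split_max d A x : x \in A -> {in A, forall w, d w <= d x} ->
  (weight d A =
   2%:R * ((degin A x)%:R / (d x)%:R) + weight d (A :\ x))%R.
Proof.
move=> xA xmax; rewrite (weight_split _ xA) (deginD1 _ xA) adj_irrefl add0n.
rewrite deginE mulr_suml; congr (_ * _ + _)%R; apply: eq_bigr => w.
by rewrite inE => /andP[_ wA]; rewrite (maxn_idPl _) ?xmax.
Qed.

Lemma exists_argmax d A : A != set0 ->
  exists2 x, x \in A & {in A, forall w, d w <= d x}.
Proof. by case/set0Pn=> x0 x0A; case: (arg_maxnP d x0A) => x; exists x. Qed.

Lemma exists_argmin d A : A != set0 ->
  exists2 x, x \in A & {in A, forall w, d x <= d w}.
Proof. by case/set0Pn=> x0 x0A; case: (arg_minnP d x0A) => x; exists x. Qed.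

Lemma degin_setD1_neq0 A x : 0 < degin A x -> A :\ x != set0.
Proof.
case/degin_gt0P=> w wA xw; apply/set0Pn; exists w; rewrite !inE wA andbT.
by apply: contraTneq xw => ->; rewrite adj_irrefl.
Qed.

(** The condition on [d] and [j] is the trace left on [A] by having removed [j]
    vertices from a set in which [d] counts the degrees; this lemma
    is one more round of peeling. *)
Lemma degin_setD1_slack d A x j : x \in A ->
  {in A, forall u, d u <= degin A u + j} ->
  {in A :\ x, forall u, d u <= degin (A :\ x) u + j.+1}.
Proof.
move=> xA le_d u; rewrite inE => /andP[_ uA].
by have := le_d u uA; rewrite (deginD1 u xA); case: (adj u x); lia.
Qed.

(** The peeling argument, with [j] vertices already removed and minimum degree
    [j + i]: a vertex of largest remaining degree [e] contributes at least
    [2 (e - j) / e >= 2 i / (j + i)], and in the rounds that follow [i] is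
    replaced in turn by [i - 1, ..., 1]. *)
Lemma weight_ge i j d A : A != set0 ->
    {in A, forall u, j + i <= d u} ->
    {in A, forall u, d u <= degin A u + j} ->
  ((i * i.+1)%:R / (j + i)%:R <= weight d A)%R.
Proof.
elim: i j A => [|i IHi] j A A0 ge_d le_d; first by rewrite mul0n mul0r weight_ge0.
have [x xA xmax] := exists_argmax d A0.
have dx := le_d x xA; have dx' := ge_d x xA.
have Ax0 : A :\ x != set0 by apply: degin_setD1_neq0; lia.
have /(_ j.+1 _ Ax0) := IHi; rewrite addSnnS => {}IHi.
have {}IHi := IHi (fun u uA => ge_d u (subsetP (subsetDl _ _) u uA))
   (degin_setD1_slack xA le_d).
rewrite (weight_split_max xA xmax).
have step : ((i.+1)%:R / (j + i.+1)%:R <= (degin A x)%:R / (d x)%:R :> rat)%R.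
  rewrite ler_pdivrMr ?ltr0n ?addnS // mulrAC ler_pdivlMr ?ltr0n; last lia.
  by rewrite -!natrM ler_nat; nia.
apply: le_trans (lerD (ler_wpM2l (ler0n _ 2) step) IHi).
(* Both bounds have denominator [j + i.+1]; only the numerators differ. *)
have -> : (i.+1 * i.+2 = 2 * i.+1 + i * i.+1)%N by nia.
by rewrite natrD natrM mulrDl mulrA.
Qed.

(** * Vertex sets of large minimum degree *)

(** The clique [C] with pendant vertices at [c], described inside [G] rather than
    up to isomorphism, so that an induction on [S] can keep the same [C]. *)
Definition is_clique_star S C c : Prop :=
  [/\ c \in C, C \subset S, {in C &, forall x y, x != y -> adj x y}
    & {in S, forall x, x \notin C -> {in S, forall y, adj x y = (y == c)}}].

Lemma dweight_split_max S x : x \in S -> 0 < degin S x ->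
    {in S, forall w, degin S w <= degin S x} ->
  (dweight S = 2%:R + weight (degin S) (S :\ x))%R.
Proof.
move=> xS dx xmax; rewrite /dweight (weight_split_max xS xmax).
by rewrite divff ?mulr1 // pnatr_eq0 -lt0n.
Qed.

Lemma le_degin_setD1 S x : x \in S ->
  {in S :\ x, forall u, degin S u <= degin (S :\ x) u + 1}.
Proof. by move=> xS u _; rewrite (deginD1 u xS); case: (adj u x); lia. Qed.

Lemma min_degree_dweight_ge k S : 0 < k -> S != set0 ->
  {in S, forall u, k <= degin S u} -> (k.+1%:R <= dweight S)%R.
Proof.
move=> k0 S0 kS; have := @weight_ge k 0 (degin S) S S0 kS.
rewrite natrM add0n mulrAC divff ?pnatr_eq0 -?lt0n // mul1r; apply.
by move=> u _; rewrite addn0.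
Qed.

Lemma weight_eq0 d A u w : weight d A = 0%R -> {in A, forall x, 0 < d x} ->
  u \in A -> w \in A -> ~~ adj u w.
Proof.
move=> W0 d0 uA wA.
have pos x y : (0 <= (adj x y)%:R / (maxn (d x) (d y))%:R :> rat)%R.
  by rewrite divr_ge0 ?ler0n.
have /eqP := W0; rewrite psumr_eq0 => [/allP/(_ u)|x _]; last exact: sumr_ge0.
rewrite mem_index_enum uA => /(_ isT) /=.
rewrite psumr_eq0 // => /allP/(_ w); rewrite mem_index_enum wA => /(_ isT) /=.
rewrite mulf_eq0 invr_eq0 !pnatr_eq0 eqb0 => /orP[//|].
by have := d0 u uA; lia.
Qed.

(** A star counts as a clique of size 2 (the centre and any one leaf) with
    the other leaves pendant, so that the size of the clique is always the
    chromatic number. *)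
Lemma star_is_clique_star S x :
    x \in S -> {in S, forall u, 0 < degin S u} ->
    {in S :\ x &, forall u w, ~~ adj u w} ->
  exists C c, is_clique_star S C c /\ #|C| = 2.
Proof.
move=> xS noiso indep; have /degin_gt0P[y yS xy] := noiso x xS.
have nxy : x != y by apply: contraTneq xy => ->; rewrite adj_irrefl.
have centre u : u \in S -> u != x -> {in S, forall w, adj u w = (w == x)}.
  move=> uS ux w wS; have [->|wx] := eqVneq w x.
    have /degin_gt0P[z zS uz] := noiso u uS.
    have [<- //|zx] := eqVneq z x.
    by have := indep u z; rewrite !inE ux zx uS zS uz => /(_ isT isT).
  by apply/negbTE/indep; rewrite !inE ?ux ?wx.
exists [set x; y], x; rewrite cards2 nxy; split=> //; split.
- by rewrite !inE eqxx.
- by apply/subsetP=> z; rewrite !inE => /orP[]/eqP->.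
- move=> a b; rewrite !inE => /orP[]/eqP-> /orP[]/eqP->; rewrite ?eqxx //.
  by rewrite adj_sym.
- move=> u uS; rewrite !inE negb_or => /andP[ux _]; exact: centre.
Qed.

Lemma complete_is_clique_star k S : S != set0 -> #|S| <= k.+1 ->
    {in S, forall u, k <= degin S u} ->
  exists C c, is_clique_star S C c /\ #|C| = k.+1.
Proof.
case/set0Pn=> c cS le_S kS.
have sub := neighbours_subD1 S.
have cardS u : u \in S -> #|S| = #|S :\ u|.+1 by move=> uS; rewrite (cardsD1 u) uS.
exists S, c; split; [split=> // [x y xS yS xy|x ->] //|].
- have /eqP eqN : [set w in S | adj x w] == S :\ x.
    rewrite eqEcard sub; have := kS x xS; rewrite -/(degin S x).
    by have := cardS x xS; lia.
  have : y \in S :\ x by rewrite !inE eq_sym xy.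
  by rewrite -eqN inE => /andP[].
- have := kS c cS; have := subset_leq_card (sub c).
  by rewrite -/(degin S c); have := cardS c cS; lia.
Qed.

(** Removing a vertex [x] of largest degree costs exactly 2, so equality says
    that the rest weighs [k - 1].  For [k = 1] the rest has no edges.  For
    [k >= 2], equality in the second round of peeling forces all degrees in the
    rest to be [k]; then its [#|S| - 1] vertices weigh at least [(k - 1) / k]
    each, which leaves room for at most [k] of them. *)
Lemma min_degree_dweight_eq k S : 0 < k -> S != set0 ->
    {in S, forall u, k <= degin S u} -> dweight S = (k.+1%:R)%R ->
  exists C c, is_clique_star S C c /\ #|C| = k.+1.
Proof.
move=> k0 S0 kS; have [x xS xmax] := exists_argmax (degin S) S0.
have dx := kS x xS.
have posS : {in S, forall u, 0 < degin S u} by move=> u /kS; lia.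
have subS u : u \in S :\ x -> u \in S by rewrite inE => /andP[].
rewrite (dweight_split_max xS (posS x xS) xmax).
(* From here on the degree bound is [k.+1]. *)
case: k k0 kS dx => [//|k] _ kS dx /eqP.
rewrite -[in X in _ == X]add2n natrD (inj_eq (addrI _)) => /eqP WE.
case: (posnP k) => [k0|k_gt0].
  rewrite k0 in WE *; apply: (star_is_clique_star xS posS).
  by move=> u w uS wS; apply: (weight_eq0 WE _ uS wS) => z /subS /posS.
have Sx0 : S :\ x != set0 by apply: degin_setD1_neq0; apply: posS.
have [y ySx ymax] := exists_argmax (degin S) Sx0.
have slack := le_degin_setD1 xS.
have dy := slack y ySx; have dy' := kS y (subS y ySx).
have Sxy0 : S :\ x :\ y != set0 by apply: degin_setD1_neq0; lia.
have eq_k : {in S :\ x, forall u, degin S u = k.+1}.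
  suff le_dy : degin S y <= k.+1.
    move=> u uSx; have := ymax u uSx; have := kS u (subS u uSx); lia.
  have rest : ((k.-1 * k)%:R / k.+1%:R <= weight (degin S) (S :\ x :\ y))%R.
    have := @weight_ge k.-1 2 (degin S) _ Sxy0.
    rewrite (_ : 2 + k.-1 = k.+1)%N ?prednK //; last lia.
    apply; last exact: degin_setD1_slack.
    by move=> u; rewrite inE => /andP[_ /subS/kS].
  move: WE; rewrite (weight_split_max ySx ymax) => WE.
  have dy_gt0 : (0 < (degin S y)%:R :> rat)%R by rewrite ltr0n; lia.
  have k1_gt0 : (0 < k.+1%:R :> rat)%R by rewrite ltr0n.
  have le1 : (((degin S y).-1)%:R / (degin S y)%:R <=
              (degin (S :\ x) y)%:R / (degin S y)%:R :> rat)%R.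
    by rewrite ler_pM2r ?invr_gt0 // ler_nat; lia.
  have : (2%:R * (((degin S y).-1)%:R / (degin S y)%:R) + (k.-1 * k)%:R / k.+1%:R
          <= k%:R :> rat)%R.
    by rewrite -WE lerD // ler_pM2l.
  rewrite -(ler_pM2r k1_gt0) -(ler_pM2r dy_gt0).
  rewrite (_ : (_ * _ * _ = (2 * (degin S y).-1 * k.+1 + k.-1 * k * degin S y)%:R)%R).
    by rewrite -!natrM ler_nat; nia.
  have clear_denominators (a b p q : rat) : (b != 0 -> q != 0 ->
      (2%:R * (a / b) + p / q) * q * b = 2%:R * a * q + p * b)%R.
    by move=> b0 q0; field; rewrite q0 b0.
  by rewrite clear_denominators ?lt0r_neq0 // natrD !natrM.
apply: (complete_is_clique_star S0 _ kS).
have : ((#|S :\ x| * k)%:R / k.+1%:R <= k%:R :> rat)%R.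
  rewrite -WE /weight natrM -mulrA mulr_natl -sumr_const.
  apply: ler_sum => u uSx.
  rewrite (eq_bigr (fun w => (adj u w)%:R / k.+1%:R)%R) => [|w wSx].
    rewrite -mulr_suml -deginE ler_pM2r ?invr_gt0 ?ltr0n // ler_nat.
    by have := slack u uSx; have := kS u (subS u uSx); lia.
  by rewrite !eq_k // maxnn.
rewrite ler_pdivrMr ?ltr0n // -natrM ler_nat (cardsD1 x S) xS; nia.
Qed.

(** * Deleting a vertex of minimum degree *)

Section DeleteMinDegree.
Variables (S : {set G}) (v : G).
Hypotheses (vS : v \in S) (vmin : {in S, forall w, degin S v <= degin S w}).

Let S' := S :\ v.
Let d := degin S.
Let d' := degin S'.

(** When [u] becomes isolated, [(d' u)%:R^-1] is 0 and [drop u] meaningless; it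
    then enters below only with the factor [d' u = 0], or for an edge at [u]
    in [S'], of which there is none. *)
Let drop u : rat := ((d' u)%:R^-1 - (d u)%:R^-1)%R.
(** What the edge [vu] loses beyond what the other edges at [u] can claim
    back. *)
Let excess u : rat := ((adj v u)%:R / (d u)%:R - (d' u)%:R * drop u)%R.
(** What the endpoints allow the edge [uw] to gain beyond its
    actual gain. *)
Let slack u w : rat :=
  ((adj u w)%:R * (drop u + drop w
     - ((maxn (d' u) (d' w))%:R^-1 - (maxn (d u) (d w))%:R^-1)))%R.

Let dE u : d u = adj v u + d' u.
Proof. by rewrite /d (deginD1 u vS) adj_sym. Qed.

Let d'_gt0 u w : w \in S' -> adj u w -> 0 < d' u.
Proof. by move=> wS uw; apply/degin_gt0P; exists w. Qed.

(** The accounting identity behind both the inequality and its equality case: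
    the loss is written as a sum of terms that are all nonnegative. *)
Lemma dweight_setD1 :
  (dweight S = dweight S' +
     \sum_(u in S') (2%:R * excess u + \sum_(w in S') slack u w))%R.
Proof.
rewrite {1}/dweight (weight_split _ vS) -/S' -/d.
have -> : (\sum_(w in S') (adj v w)%:R / (maxn (d v) (d w))%:R =
           \sum_(w in S') excess w + \sum_(w in S') (d' w)%:R * drop w)%R.
  rewrite -big_split; apply: eq_bigr => w; rewrite inE => /andP[_ wS].
  by rewrite (maxn_idPr (vmin wS)) /= subrK.
have -> : (weight d S' = dweight S' + \sum_(u in S') \sum_(w in S') slack u w
              - 2%:R * \sum_(w in S') (d' w)%:R * drop w)%R.
  have E1 : (\sum_(u in S') (d' u)%:R * drop u =
             \sum_(u in S') \sum_(w in S') (adj u w)%:R * drop u :> rat)%R.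
    by apply: eq_bigr => u _; rewrite deginE mulr_suml.
  have E2 : (\sum_(u in S') (d' u)%:R * drop u =
             \sum_(u in S') \sum_(w in S') (adj u w)%:R * drop w :> rat)%R.
    rewrite E1 exchange_big; apply: eq_bigr => u _; apply: eq_bigr => w _.
    by rewrite adj_sym.
  have -> : (\sum_(u in S') \sum_(w in S') slack u w =
      \sum_(u in S') \sum_(w in S') (adj u w)%:R * drop u
      + \sum_(u in S') \sum_(w in S') (adj u w)%:R * drop w
      - dweight S' + weight d S')%R.
    rewrite /dweight /weight -big_split -sumrB -big_split /=.
    apply: eq_bigr => u _; rewrite -big_split -sumrB -big_split /=.
    by apply: eq_bigr => w _; rewrite /slack; ring.
  by rewrite -E1 -E2; ring.
by rewrite [in RHS]big_split /= -mulr_sumr; ring.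
Qed.

Lemma excess_ge0 u : (0 <= excess u)%R.
Proof.
rewrite /excess /drop dE; case: (adj v u); last by rewrite subrr mulr0 mul0r subrr.
case: (d' u) => [|e]; first by rewrite mul0r subr0 divr_ge0 ?ler0n.
have e1 : (e.+1%:R != 0 :> rat)%R by rewrite pnatr_eq0.
have e2 : (e.+1%:R + 1 != 0 :> rat)%R by rewrite natr1 pnatr_eq0.
rewrite add1n -(natr1 e.+1) mulr1n (_ : (_ - _ = 0)%R) //.
move: (e.+1%:R)%R e1 e2 => a a0 a1.
by field; rewrite a1 a0.
Qed.

Lemma slack_ge0 u w : u \in S' -> w \in S' -> (0 <= slack u w)%R.
Proof.
move=> uS wS; rewrite /slack; case: (boolP (adj u w)) => [uw|_]; last by rewrite mul0r.
rewrite mul1r subr_ge0; apply: inv_max_drop_le; rewrite ?dE ?leq_addl //.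
  exact: d'_gt0 uw.
by rewrite adj_sym in uw; exact: d'_gt0 uw.
Qed.

Lemma dweight_setD1_le : (dweight S' <= dweight S)%R.
Proof.
rewrite dweight_setD1 lerDl; apply: sumr_ge0 => u uS.
by rewrite addr_ge0 ?mulr_ge0 ?excess_ge0 // sumr_ge0 // => w; apply: slack_ge0.
Qed.

(** All terms of the accounting identity vanish.  A neighbour [u] of [v] of
    degree 1 has excess 1, and zero slack on an edge [uw] means that [u] alone
    determines its weight, before and after the deletion. *)
Lemma dweight_setD1_eq u : dweight S' = dweight S -> u \in S' -> adj v u ->
  1 < degin S u /\
  {in S', forall w, adj u w -> ~~ adj v w /\ degin S w < degin S u}.
Proof.
move=> /eqP; rewrite dweight_setD1 -subr_eq0 opprD addNKr oppr_eq0 => eq0 uS vu.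
have inner_ge0 x : x \in S' -> (0 <= \sum_(w in S') slack x w)%R.
  by move=> xS; apply: sumr_ge0 => w; apply: slack_ge0.
move: eq0; rewrite psumr_eq0 => [/allP/(_ u)|x xS]; last first.
  by rewrite addr_ge0 ?mulr_ge0 ?excess_ge0 ?inner_ge0.
rewrite mem_index_enum uS => /(_ isT) /=.
rewrite paddr_eq0 ?mulr_ge0 ?excess_ge0 ?inner_ge0 // => /andP[ex0 sl0].
split.
  move: ex0; rewrite mulf_eq0 /= /excess -/d dE vu.
  case: (d' u) => [|//]; rewrite mul0r subr0 add1n.
  by rewrite mul1r invr1 !oner_eq0.
move=> w wS uw; have {sl0} /eqP : slack u w == 0%R.
  move: sl0; rewrite psumr_eq0 => [/allP/(_ w)|x xS]; last exact: slack_ge0.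
  by rewrite mem_index_enum wS => /(_ isT).
rewrite /slack uw mul1r => /eqP; rewrite subr_eq0 eq_sym => /eqP.
have wu : adj w u by rewrite adj_sym.
have lt_u : d' u < d u by rewrite dE vu.
have le_w : d' w <= d w by rewrite dE leq_addl.
move=> /(inv_max_drop_eq (d'_gt0 wS uw) (d'_gt0 uS wu) le_w)/(_ lt_u).
rewrite -/d => -[eq_w ->]; split=> //.
by move: eq_w; rewrite dE; case: (adj v w) => //; lia.
Qed.

End DeleteMinDegree.

(** * Sets that are not k-colourable *)

(** Colours are natural numbers and only their values on [S] matter, so a
    colouring is its own restriction to a smaller set. *)
Definition colorable_on S k : Prop :=
  exists2 f : G -> nat, {in S, forall x, f x < k}
    & {in S &, forall x y, adj x y -> f x != f y}.

Lemma colorable_on_setD1 S v k : v \in S -> degin S v < k ->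
  colorable_on (S :\ v) k -> colorable_on S k.
Proof.
move=> vS dv [f f_lt f_proper].
pose N := enum [set w in S | adj v w].
have [i i_lt i_free] : exists2 i, i < k & i \notin map f N.
  case: (boolP (all (mem (map f N)) (iota 0 k))) => [/allP sub|/allPn[i]].
    have := uniq_leq_size (iota_uniq 0 k) sub.
    by rewrite size_iota size_map -cardE leqNgt dv.
  by rewrite mem_iota; exists i.
have free x : x \in S -> adj v x -> f x != i.
  move=> xS vx; apply: contraNneq i_free => <-; apply: map_f.
  by rewrite mem_enum inE xS.
exists (fun x => if x == v then i else f x) => [x xS|x y xS yS xy].
  by case: eqP => // /eqP xv; apply: f_lt; rewrite !inE xv.
have [xv|xv] := eqVneq x v; have [yv|yv] := eqVneq y v.
- by rewrite xv yv adj_irrefl in xy.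
- by rewrite eq_sym free // -xv.
- by rewrite free // -yv adj_sym.
- by rewrite f_proper // !inE ?xv ?yv.
Qed.

Lemma colorable_on_set0 k : colorable_on set0 k.
Proof. by exists (fun _ => 0) => x; rewrite inE. Qed.

Lemma clique_star_centre_adj S C c x :
  is_clique_star S C c -> x \in S -> x != c -> adj c x.
Proof.
case=> cC /subsetP CS clique pendant xS xc.
have [xC|xC] := boolP (x \in C); first by rewrite clique // eq_sym.
by rewrite adj_sym (pendant x xS xC c) ?CS.
Qed.

(** The centre is adjacent to all other vertices, so a vertex [v] attached to
    it has no further neighbour.  If [v] is attached to some other [u] instead,
    the degree of [u] must exceed that of the centre [c0]; as [u] has at most
    [#|C| - 1] old neighbours, this leaves no pendant vertex, and in
    the complete graph [C] the vertex [u] can serve as centre. *)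
Lemma clique_star_add_vertex S C c0 v : v \in S -> 0 < degin S v ->
    is_clique_star (S :\ v) C c0 -> 2 < #|C| ->
    {in S :\ v, forall u, adj v u ->
       {in S :\ v, forall w, adj u w ->
          ~~ adj v w /\ degin S w < degin S u}} ->
  exists c, is_clique_star S C c.
Proof.
move=> vS /degin_gt0P[u uS vu] star0 C_gt2 dominant.
have attach c : is_clique_star (S :\ v) C c -> adj v c -> is_clique_star S C c.
  move=> star vc; have cAdj := clique_star_centre_adj star.
  have [cC /subsetP CS clique pendant] := star.
  have vN x : x \in S :\ v -> x != c -> adj v x = false.
    move=> xS xc; apply/negbTE.
    by have [] := dominant c (CS c cC) vc x xS (cAdj x xS xc).
  have cv : v != c by apply: contraTneq vc => ->; rewrite adj_irrefl.
  split=> // [|x xS xC y yS].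
    by apply/subsetP => x /CS; rewrite inE => /andP[].
  have xc : x != c by apply: contraNneq xC => ->.
  have [xv|xv] := eqVneq x v; have [yv|yv] := eqVneq y v.
  - by rewrite xv yv adj_irrefl (negbTE cv).
  - rewrite xv; have [->//|yc] := eqVneq y c.
    by apply: vN; rewrite // !inE yv.
  - by rewrite yv adj_sym (negbTE cv) vN // !inE xv.
  - by rewrite pendant // !inE ?xv ?yv.
have uS' : u \in S :\ v.
  by rewrite !inE uS andbT; apply: contraTneq vu => ->; rewrite adj_irrefl.
have [vc0|vc0] := boolP (adj v c0); first by exists c0; apply: attach.
have uc0 : u != c0 by apply: contraNneq vc0 => <-.
have [c0C /subsetP CS clique pendant] := star0.
have [_ lt_d] : ~~ adj v c0 /\ degin S c0 < degin S u.
  apply: (dominant u uS' vu c0 (CS c0 c0C)).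
  by rewrite adj_sym; apply: clique_star_centre_adj star0 uS' uc0.
have le_u : degin (S :\ v) u < #|C|.
  have [uC|uC] := boolP (u \in C).
    rewrite (cardsD1 u C) uC ltnS; apply/subset_leq_card/subsetP => w.
    rewrite !inE => /andP[/andP[wv wS] uw]; apply/andP; split.
      by apply: contraTneq uw => ->; rewrite adj_irrefl.
    apply: contraTT uw => wC; rewrite adj_sym pendant ?(negbTE uc0) //.
    by rewrite !inE wv.
  apply: leq_ltn_trans (ltn_trans (ltnSn 1) C_gt2).
  rewrite -(cards1 c0); apply/subset_leq_card/subsetP => w.
  by rewrite inE => /andP[wS]; rewrite pendant // inE.
(* [c0] is adjacent to all of the old set. *)
have ge_c0 : #|S :\ v| <= (degin (S :\ v) c0).+1.
  rewrite (cardsD1 c0) (CS c0 c0C) ltnS; apply/subset_leq_card/subsetP => w.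
  rewrite in_setD1 => /andP[wc0 wS].
  by rewrite inE wS (clique_star_centre_adj star0).
move: lt_d; rewrite !(deginD1 _ vS) !(adj_sym _ v) vu (negbTE vc0) => lt_d.
have eqC : C = S :\ v.
  by apply/eqP; rewrite eqEcard; apply/andP; split; [apply/subsetP|lia].
exists u; apply: (attach u) => //.
by split=> //; rewrite eqC // => x ->.
Qed.

Theorem dweight_not_colorable k S : 0 < k -> ~ colorable_on S k ->
  (k.+1%:R <= dweight S)%R /\
  (dweight S = (k.+1%:R)%R -> {in S, forall u, 0 < degin S u} ->
   exists C c, is_clique_star S C c /\ #|C| = k.+1).
Proof.
move=> k_gt0; elim: {S}_.+1 {-2}S (ltnSn #|S|) => // m IHm S leSm nocol.
have S0 : S != set0.
  by apply/eqP => S0; apply: nocol; rewrite S0; exact: colorable_on_set0.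
have [v vS vmin] := exists_argmin (degin S) S0.
have [k_le|v_lt] := leqP k (degin S v).
  have kS : {in S, forall u, k <= degin S u}.
    by move=> u uS; exact: leq_trans k_le (vmin u uS).
  split; first exact: min_degree_dweight_ge.
  by move=> eqk _; exact: min_degree_dweight_eq.
have nocol' : ~ colorable_on (S :\ v) k.
  by move=> col; apply/nocol/(colorable_on_setD1 vS v_lt col).
have [|ge' eq'] := IHm (S :\ v) _ nocol'.
  by move: leSm; rewrite (cardsD1 v) vS.
have le' := dweight_setD1_le vS vmin.
split=> [|eqk noiso]; first exact: le_trans ge' le'.
have eqS : dweight (S :\ v) = dweight S.
  by apply/eqP; rewrite eq_le le' eqk ge'.
have dom u := dweight_setD1_eq vS vmin (u := u) eqS.
have [||C [c [star cardC]]] := eq'; first by rewrite eqS.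
  move=> u uS; have uS' : u \in S by move: uS; rewrite inE => /andP[].
  have := noiso u uS'; rewrite (deginD1 u vS) adj_sym.
  case: (boolP (adj v u)) => //= vu _.
  by have [] := dom u uS vu; rewrite (deginD1 u vS) adj_sym vu.
(* [v] is not isolated, so [0 < degin S v < k]. *)
have C_gt2 : 2 < #|C| by have := noiso v vS; lia.
have [|c' star'] := clique_star_add_vertex vS (noiso v vS) star C_gt2.
  by move=> u uS vu; have [] := dom u uS vu.
by exists C, c'.
Qed.

(** * The weight of a clique with pendant vertices *)

(** The edges at the centre account for 2; each of the other [#|C| - 1]
    vertices of the clique accounts for [(#|C| - 2) / (#|C| - 1)]. *)
Lemma clique_star_dweight_le S C c :
  is_clique_star S C c -> 1 < #|C| -> (dweight S <= #|C|%:R)%R.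
Proof.
move=> star C_gt1; have cAdj := clique_star_centre_adj star.
have [cC /subsetP CS clique pendant] := star.
have dc : degin S c = #|S :\ c|.
  apply: eq_card => w; rewrite !inE andbC; have [->|wc] := eqVneq w c.
    by rewrite adj_irrefl.
  by case: (boolP (w \in S)) => [wS|]; rewrite ?andbF // cAdj.
have cS := CS c cC.
have dmax : {in S, forall w, degin S w <= degin S c}.
  move=> w wS; apply: leq_trans (subset_leq_card (neighbours_subD1 S w)) _.
  by rewrite dc; have := cardsD1 w S; rewrite wS (cardsD1 c S) cS; lia.
have CcS : C :\ c \subset S :\ c by apply/setSD/subsetP.
rewrite (dweight_split_max cS) // => [|]; last first.
  rewrite dc; apply: leq_trans (subset_leq_card CcS).
  by rewrite (cardsD1 c) cC in C_gt1.
have -> : (#|C|%:R = 2%:R + (#|C| - 2)%:R :> rat)%R by rewrite -natrD subnKC.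
rewrite lerD2l /weight (big_setID (C :\ c)) /= (setIidPr CcS).
have zero (u w : G) : u \in S :\ c -> u \notin C -> w \in S :\ c -> adj u w = false.
  rewrite !inE => /andP[uc uS] uC /andP[wc wS].
  by rewrite pendant // (negbTE wc).
rewrite [X in (_ + X)%R]big1 ?addr0 => [|u]; last first.
  rewrite !inE => /andP[uC /andP[uc uS]]; apply: big1 => w wS.
  by rewrite zero ?mul0r // ?inE ?uc //; move: uC; rewrite uc.
have cardC : #|C :\ c| = #|C|.-1 by rewrite (cardsD1 c C) cC.
have cC1 : (0 < #|C|.-1%:R :> rat)%R by rewrite ltr0n; lia.
have bound u : u \in C :\ c ->
  (\sum_(w in S :\ c) (adj u w)%:R / (maxn (degin S u) (degin S w))%:R
     <= (#|C| - 2)%:R / #|C|.-1%:R :> rat)%R.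
  move=> uCc; have uC : u \in C by move: uCc; rewrite inE => /andP[].
  have uSc := subsetP CcS u uCc.
  have du : #|C|.-1 <= degin S u.
    rewrite [#|C|](cardsD1 u) uC; apply/subset_leq_card/subsetP => w.
    rewrite !inE => /andP[wu wC]; rewrite CS //=; apply: clique => //.
    by rewrite eq_sym.
  apply: (@le_trans _ _ ((degin (S :\ c) u)%:R / #|C|.-1%:R)%R); last first.
    rewrite ler_pM2r ?invr_gt0 // ler_nat.
    have : degin (S :\ c) u <= #|C :\ c :\ u|.
      apply/subset_leq_card/subsetP => w.
      rewrite [_ \in [set _ in _ | _]]inE => /andP[wS uw].
      have := subsetP (neighbours_subD1 (S :\ c) u) w.
      rewrite inE wS uw => /(_ isT).
      rewrite !inE => /and3P[-> -> _] /=.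
      by apply: contraTT uw => wC; rewrite adj_sym zero.
    by have := cardsD1 u (C :\ c); rewrite uCc cardC; lia.
  rewrite deginE mulr_suml; apply: ler_sum => w _.
  rewrite ler_wpM2l ?ler0n // inv_nat_le //; first lia.
  by rewrite leq_max du.
apply: (@le_trans _ _ (\sum_(u in C :\ c) (#|C| - 2)%:R / #|C|.-1%:R)%R).
  exact: ler_sum.
by rewrite sumr_const cardC -(mulr_natr (_ / _)) divfK ?lt0r_neq0.
Qed.

(** * Comparison with the invariants of the whole graph *)

Lemma deg_degin u : deg u = degin setT u.
Proof. by apply: eq_card => w; rewrite !inE. Qed.

Lemma dweightT : (dweight [set: G] = 2%:R * Rprime G)%R.
Proof.
pose m (p : G * G) := maxn (deg p.1) (deg p.2).
have -> : (dweight [set: G] = \sum_(p : G * G | adj p.1 p.2) (m p)%:R^-1)%R.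
  rewrite /dweight /weight pair_big big_mkcond [RHS]big_mkcond /=.
  apply: eq_bigr => p _; rewrite !inE /= /m !deg_degin.
  by case: (adj _ _); rewrite ?mul1r ?mul0r.
rewrite (partition_big (fun p : G * G => [set p.1; p.2]) (mem (edges G))) /=.
  rewrite /Rprime mulr_sumr; apply: eq_bigr => A /imsetP[[u v]].
  rewrite inE /= => uv ->.
  have nuv : u != v by apply: contraTneq uv => ->; rewrite adj_irrefl.
  have maxE (x y : G) : x != y ->
      \max_(w in [set x; y]) deg w = maxn (deg x) (deg y).
    by move=> xy; rewrite big_setU1 ?inE //= big_set1.
  rewrite (eq_bigr (fun _ => (\max_(w in [set u; v]) deg w)%:R^-1)%R).
    rewrite sumr_const; set P := (X in #|X|).
    suff -> : #|P| = 2 by rewrite mulr_natl.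
    rewrite (_ : #|P| = #|[set (u, v); (v, u)]|).
      by rewrite cards2 xpair_eqE (negbTE nuv).
    apply: eq_card => -[x y]; rewrite !inE !xpair_eqE /= unfold_in /=.
    apply/andP/orP => [[xy /eqP eqA]|[]/andP[/eqP-> /eqP->]]; last first.
    - by rewrite adj_sym uv setUC.
    - by rewrite uv.
    have nxy : x != y by apply: contraTneq xy => ->; rewrite adj_irrefl.
    have : x \in [set u; v] by rewrite -eqA !inE eqxx.
    have : y \in [set u; v] by rewrite -eqA !inE eqxx orbT.
    rewrite !inE => /orP[]/eqP yE /orP[]/eqP xE; move: nxy; rewrite xE yE ?eqxx //.
      by right.
    by left.
  move=> [x y] /= /andP[xy /eqP <-]; rewrite maxE //.
  by apply: contraTneq xy => ->; rewrite adj_irrefl.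
by move=> [x y] xy; apply/imsetP; exists (x, y); rewrite ?inE.
Qed.

(** The isomorphism is built backwards, enumerating [C] with [c] first: a map
    out of the sum type needs only list lookups. *)
Lemma clique_star_isomorphic C c : is_clique_star [set: G] C c ->
  isomorphic G (clique_star #|C| #|G|).
Proof.
move=> star; have cAdj x := clique_star_centre_adj star (in_setT x).
have [cC _ clique pendant] := star.
pose s := c :: enum (C :\ c); pose t := enum (~: C).
have s_uniq : uniq s by rewrite /= enum_uniq mem_enum !inE eqxx.
have s_size : size s = #|C| by rewrite /= -cardE (cardsD1 c C) cC.
have t_size : size t = #|G| - #|C| by rewrite -cardE cardsCs setCK.
have sC x : x \in s -> x \in C.
  by rewrite inE mem_enum !inE => /orP[/eqP->|/andP[]].
pose g (a : clique_star #|C| #|G|) : G :=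
  match a with inl i => nth c s i | inr j => nth c t j end.
have gl i : g (inl i) \in C by apply/sC/mem_nth; rewrite s_size.
have gr j : g (inr j) \notin C.
  have : g (inr j) \in t by apply: mem_nth; rewrite t_size.
  by rewrite mem_enum inE.
have gc i : (g (inl i) == c) = (i == 0 :> nat).
  by rewrite -[X in _ == X]/(nth c s 0) nth_uniq ?s_size // (cardsD1 c C) cC.
have gll i j : (g (inl i) == g (inl j)) = (i == j).
  by rewrite nth_uniq ?s_size.
have g_inj : injective g.
  move=> [i|i] [j|j] eq_g.
  - by congr inl; apply/eqP; rewrite -gll eq_g.
  - by have := gl i; rewrite eq_g (negbTE (gr j)).
  - by have := gr i; rewrite eq_g gl.
  - congr inr; apply/eqP; rewrite -val_eqE.
    rewrite -(nth_uniq c (s := t)) ?t_size ?enum_uniq ?(valP i, valP j) //.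
    exact/eqP.
have g_adj a b : adj (g a) (g b) = adj a b.
  case: a b => [i|i] [j|j].
  - rewrite [RHS]/= -gll; have [->|ne] := eqVneq; first exact: adj_irrefl.
    exact: clique.
  - by rewrite adj_sym pendant ?inE ?gc.
  - by rewrite pendant ?inE ?gc.
  - rewrite pendant ?inE //; apply/eqP => eq_c.
    by have := gr j; rewrite eq_c cC.
have [|h gK hK] := inj_card_bij g_inj.
  by rewrite card_clique_star ?max_card.
by exists h => [|x y]; [exists g | rewrite -g_adj !hK].
Qed.

Lemma isomorphic_clique_star k n : 0 < k -> (forall u : G, 0 < deg u) ->
    isomorphic G (clique_star k n) ->
  exists C c, is_clique_star [set: G] C c /\ 1 < #|C|.
Proof.
case: k => // k _ noiso [f [h fK hK] f_adj].
have f_inj := can_inj fK.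
pose c := h (inl ord0).
have noisoT : {in [set: G], forall u, 0 < degin setT u}.
  by move=> u _; rewrite -deg_degin.
case: k f h fK hK f_adj f_inj @c => [|k] f h fK hK f_adj f_inj c.
  (* [k = 1]: the clique is a single vertex, so another one has to be added. *)
  have [|C [c' [star C2]]] := star_is_clique_star (in_setT c) noisoT.
    move=> u w; rewrite !inE !andbT -(inj_eq f_inj) -[w == c](inj_eq f_inj).
    rewrite !hK -f_adj; case: (f u) => [i|i]; first by rewrite [i]ord1 eqxx.
    by case: (f w) => [j|j] //; rewrite [j]ord1 eqxx.
  by exists C, c'; rewrite C2.
pose C := [set x | if f x is inl _ then true else false].
have cC : c \in C by rewrite inE hK.
exists C, c; split; last first.
  rewrite (cardsD1 c) cC ltnS card_gt0; apply/set0Pn.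
  exists (h (inl (lift ord0 ord0))).
  by rewrite !inE hK andbT -(inj_eq f_inj) !hK.
split=> // [|x _ + y _].
- move=> x y; rewrite !inE -(inj_eq f_inj) -f_adj.
  by case: (f x) => // i; case: (f y).
- rewrite inE -(inj_eq f_inj) -f_adj hK.
  by case: (f x) => // i; case: (f y).
Qed.

Lemma colorable_onT k : colorable_on [set: G] k -> colorable G k.
Proof.
move=> [f f_lt f_proper].
apply/existsP; exists [ffun x => Ordinal (f_lt x (in_setT x))].
apply/forallP => x; apply/forallP => y; apply/implyP => xy; rewrite !ffunE.
exact: f_proper.
Qed.

Lemma clique_le_colorable C k : {in C &, forall x y, x != y -> adj x y} ->
  colorable G k -> #|C| <= k.
Proof.
move=> clique /existsP[f /forallP f_proper].
rewrite -(card_in_imset (f := f) (D := mem C)) => [|x y xC yC eqf].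
  by have := max_card (mem (f @: mem C)); rewrite card_ord.
apply/eqP; apply: contraTT isT => xy.
by have /forallP/(_ y) := f_proper x; rewrite (clique x y) // eqf eqxx.
Qed.

End Weight.

Theorem corollary1p5 (n : nat) (G : sgraph) (n_gt0 : 0 < n) (orderG : #|G| = n)
    (no_isolated : forall u : G, 0 < deg u) :
  ((chromatic_number G)%:R <= 2%:R * Rprime G)%R /\
  ((chromatic_number G)%:R%R = (2%:R * Rprime G)%R <->
   exists k : nat, 1 <= k <= n /\ isomorphic G (clique_star k n)).
Proof.
rewrite -dweightT /chromatic_number; case: ex_minnP => m col min_m.
have [x xy] : exists x : G, 0 < deg x.
  by case/card_gt0P: (leq_trans n_gt0 (eq_leq (esym orderG))) => x _; exists x.
have m_gt1 : 1 < m.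
  move: xy; rewrite card_gt0 => /set0Pn[y]; rewrite inE => xy.
  have nxy : x != y by apply: contraTneq xy => ->; rewrite adj_irrefl.
  rewrite -[1%N](_ : #|[set x; y]|.-1 = 1%N) ?cards2 ?nxy //.
  have := clique_le_colorable (C := [set x; y]) _ col; rewrite cards2 nxy; apply.
  move=> a b; rewrite !inE => /orP[]/eqP-> /orP[]/eqP->; rewrite ?eqxx //.
  by rewrite adj_sym.
have nocol : ~ colorable_on [set: G] m.-1.
  by move=> /colorable_onT/min_m; rewrite leqNgt prednK ?leqnn //; lia.
have [|ge_m eq_m] := dweight_not_colorable _ nocol; first lia.
rewrite prednK in ge_m eq_m; last lia.
split=> //; split=> [eq_w|[k [/andP[k_gt0 _] iso]]].
  have [|C [c [star cardC]]] := eq_m (esym eq_w).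
    by move=> u _; rewrite -deg_degin.
  exists #|C|; rewrite -orderG max_card cardC; split; first lia.
  by rewrite -cardC; exact: clique_star_isomorphic star.
have [C [c [star C_gt1]]] := isomorphic_clique_star k_gt0 no_isolated iso.
apply/eqP; rewrite eq_le ge_m /=.
apply: le_trans (clique_star_dweight_le star C_gt1) _.
by rewrite ler_nat; case: star => _ _ clique _; exact: clique_le_colorable col.
Qed.
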